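(* Let $X$ be a Tychonoff space. The Stone-Čech compactification $\beta X$ is indecomposable if and only if $X$ is strongly indecomposable.
   Context: A topological space $Y$ (not assumed connected or compact) is indecomposable if every connected subset of $Y$ is either dense or nowhere dense in $Y$. (For a continuum, i.e. a connected compact Hausdorff space, this agrees with the usual definition: it cannot be written as the union of two of its proper subcontinua.) A topological space $X$ is strongly indecomposable if for every two non-empty disjoint open sets $U,V\subseteq X$ there are two closed sets $A,B\subseteq X$ such that $X=A\cup B$, $A\cap U\neq\varnothing$, $B\cap U\neq\varnothing$, and $A\cap B\subseteq V$. *)

(* Defs.v *)
From HB Require Import structures.
From mathcomp Require Import all_boot all_order all_algebra.
From mathcomp Require Import all_classical all_reals all_analysis.

Set Implicit Arguments.
Unset Strict Implicit.
Unset Printing Implicit Defensive.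

Import Order.TTheory GRing.Theory Num.Theory.
Import numFieldNormedType.Exports.

Local Open Scope classical_set_scope.
Local Open Scope ring_scope.

Definition tychonoff_space (X : topologicalType) : Prop :=
  completely_regular_space X /\ hausdorff_space X.

Definition nowhere_dense (Y : topologicalType) (A : set Y) : Prop :=
  (closure A)° = set0.

Definition indecomposable (Y : topologicalType) : Prop :=
  forall C : set Y, connected C -> dense C \/ nowhere_dense C.

Definition strongly_indecomposable (X : topologicalType) : Prop :=
  forall U V : set X, open U -> open V -> U !=set0 -> V !=set0 ->
    U `&` V = set0 ->
  exists A B : set X, [/\ closed A, closed B & [/\
    [set: X] = A `|` B, A `&` U !=set0, B `&` U !=set0 & A `&` B `<=` V]].

(* In [unit_interval] and [stone_cech] a set is coerced to the corresponding
   subtype, whose canonical topology is the subspace topology. *)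
Definition unit_interval (R : realType) : topologicalType :=
  `[0 : R, 1 : R]%classic.

(* [prod_topology] carries the product topology; the factors are indexed by the
   continuous functions from X to [0, 1]. *)
Definition stone_cech_cube (R : realType) (X : topologicalType) :
    topologicalType :=
  prod_topology (fun _ : continuousType X (unit_interval R) => unit_interval R).

Definition stone_cech_eval (R : realType) (X : topologicalType) (x : X) :
    stone_cech_cube R X :=
  fun f => f x.

(* The closure of the image of X in the cube [0, 1]^C(X, [0, 1]).  All realTypes
   being isomorphic, the choice of R does not matter. *)
Definition stone_cech (R : realType) (X : topologicalType) : topologicalType :=
  closure (range (@stone_cech_eval R X)).

(* Main.v *)
Require Import Defs.
From HB Require Import structures.
From mathcomp Require Import all_boot all_order all_algebra.
From mathcomp Require Import all_classical all_reals all_analysis.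

Import Order.TTheory GRing.Theory Num.Theory.
Import numFieldNormedType.Exports.

Local Open Scope classical_set_scope.
Local Open Scope ring_scope.

(** Both implications use only four properties of the unit e : X -> βX of the
Stone-Čech compactification: βX is compact Hausdorff, e is continuous with
dense range, every continuous k : X -> [0, 1] extends along e, and the open
sets of X are the preimages of the open sets of βX.

Suppose that βX is indecomposable, and let U = e^-1(U') and V = e^-1(V') be
disjoint and non-empty.  Choose v in V and an open neighbourhood N of e(v)
whose closure lies in V'.  The complement K of N is closed, and it contains U'
because e has dense range.  In a compact Hausdorff space quasicomponents are
connected ([quasicomponent_connected]); since K is not dense, a quasicomponent
of K is nowhere dense and so cannot contain U'.  Hence some relatively clopen
A of K contains a point e(u) of U' but not all of U'.  The preimages of A and
K \ A, both enlarged by the preimage of the closure of N, are the two closed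
sets required ([indecomposable_strongly_indecomposable]).

Conversely, let C be connected in βX, neither dense nor nowhere dense, and let
D be its closure.  Choose an open N whose closure misses D, and a continuous
phi with values in [0, 1] that is 0 on N and 1 on D.  Apply strong
indecomposability to the preimages of the interior of D and of N.  As X need
not be normal, the closures of the resulting A and B in βX may meet inside D,
so they do not directly disconnect D.  But phi o e vanishes on the
intersection of A and B, so the function equal to phi o e on A and to 0 on B
is well defined and continuous.  Its extension g to βX takes only the values 0
and phi, by density, hence only the values 0 and 1 on D; both values occur
because A and B meet the preimage of the interior of D.  This disconnects D
([strongly_indecomposable_indecomposable]). *)

(** * Quasicomponents of compact Hausdorff spaces *)

Lemma regular_shrink {Y : topologicalType} :
  hausdorff_space Y -> compact [set: Y] ->
  forall (y : Y) (O : set Y), open O -> O y ->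
  exists N : set Y, [/\ open N, N y & closure N `<=` O].
Proof.
move=> hY cY y O oO Oy.
have [M My clMO] := compact_regular hY cY filterT (open_nbhs_nbhs (conj oO Oy)).
exists (M°); split; [exact: open_interior|exact: My|].
exact: subset_trans (closureS (@interior_subset _ M)) clMO.
Qed.

Lemma separated_closedl {Y : topologicalType} (A B : set Y) :
  closed (A `|` B) -> separated A B -> closed A.
Proof.
move=> clAB [cAB0 _] y cAy.
have : closure (A `|` B) y by exact: (closureS (@subsetUl _ A B)).
move=> /clAB[//|By].
by have : (closure A `&` B) y by []; rewrite cAB0.
Qed.

(** Unlike [clopen] in the type [subspace K], closedness is asked in the ambient
space, where regularity and compactness are available; for closed K the two
notions agree. *)
Definition relatively_clopen {Y : topologicalType} (K A : set Y) : Prop :=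
  [/\ A `<=` K, closed A & closed (K `\` A)].

Lemma relatively_clopenI {Y : topologicalType} (K A B : set Y) :
  relatively_clopen K A -> relatively_clopen K B ->
  relatively_clopen K (A `&` B).
Proof.
move=> [AK cA cKA] [BK cB cKB]; split; first by move=> y [/AK].
- exact: closedI.
- by rewrite setDIr; exact: closedU.
Qed.

Definition quasicomponent {Y : topologicalType} (K : set Y) (x : Y) : set Y :=
  \bigcap_(A in [set A | relatively_clopen K A /\ A x]) A.

(** The relatively clopen sets containing x are closed under finite
intersections.  If none of them were contained in O, the sets A \ O would
generate a proper filter on the compact K; a cluster point of it lies in every
A, hence in the quasicomponent, and yet outside O. *)
Lemma quasicomponent_refine {Y : topologicalType} (K : set Y) (x : Y)
    (O : set Y) :
  compact K -> closed K -> K x -> open O -> quasicomponent K x `<=` O ->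
  exists A, [/\ relatively_clopen K A, A x & A `<=` O].
Proof.
move=> cK clK Kx oO QO; apply: contrapT => noA.
pose D := [set A | relatively_clopen K A /\ A x].
have DK : D K.
  by split=> //; split=> //; rewrite setDv; exact: closed0.
have FF : Filter (filter_from D (fun A => A `\` O)).
  apply: filter_from_filter; first by exists K.
  move=> A B [cA Ax] [cB Bx]; exists (A `&` B).
    by split=> //; exact: relatively_clopenI.
  by move=> y [[Ay By] Oy].
have PF : ProperFilter (filter_from D (fun A => A `\` O)).
  apply: filter_from_proper => A [cA Ax]; apply: contrapT => AO.
  apply: noA; exists A; split=> // y Ay; apply: contrapT => Oy.
  by apply: AO; exists y.
have FD A : D A -> filter_from D (fun A => A `\` O) (A `\` O).
  by move=> DA; exists A.
have [p [Kp clp]] := cK _ PF (filterS (@subDsetl _ K O) (FD K DK)).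
have Qp : quasicomponent K x p.
  move=> A [cA Ax]; case: (cA) => _ clA _; apply: clA => B nB.
  have [y [[Ay _] By]] := clp _ B (FD A (conj cA Ax)) nB.
  by exists y.
have [y [[_ nOy] Oy]] :=
  clp _ O (FD K DK) (open_nbhs_nbhs (conj oO (QO _ Qp))).
exact: nOy.
Qed.

(** If Q = E0 + E1 were a separation with x in E0, normality gives an open U
around E0 whose closure misses E1, so Q avoids the boundary of U.  By
[quasicomponent_refine] some relatively clopen A around x avoids it too, which
makes the intersection of A and U relatively clopen: it contains x and misses
E1, although Q is contained in it. *)
Lemma quasicomponent_connected {Y : topologicalType} (K : set Y) (x : Y) :
  hausdorff_space Y -> compact [set: Y] -> closed K -> K x ->
  connected (quasicomponent K x).
Proof.
move=> hY cY clK Kx; apply: contrapT => /connectedPn[E [E0 QE sE]].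
wlog Ex : E E0 QE sE / E false x.
  move=> G; have : quasicomponent K x x by move=> A [].
  rewrite QE => -[Ex|Ex]; first exact: (G E).
  by apply: (G (E \o negb)) => //;
    [case=> /=|rewrite QE setUC|rewrite separatedC].
have clQ : closed (quasicomponent K x).
  by apply: closed_bigI => A [[]].
have clE0 : closed (E false) by apply: separated_closedl sE; rewrite -QE.
have clE1 : closed (E true).
  by move: sE; rewrite separatedC; apply: separated_closedl; rewrite setUC -QE.
have [U [oU EU clUE]] : exists U : set Y,
    [/\ open U, E false `<=` U & closure U `&` E true = set0].
  have [|B /set_nbhsP[U [oU EU UB]] clBE] :=
      compact_normal hY cY clE0 (t := ~` E true).
    apply/set_nbhsP; exists (~` E true); split=> //.
      exact: closed_openC.
    exact/disjoints_subset/separated_disjoint.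
  exists U; split=> //; apply/disjoints_subset.
  exact: subset_trans (closureS UB) clBE.
have clUE' y : closure U y -> E true y -> False.
  by move=> Uy Ey; have : (closure U `&` E true) y by []; rewrite clUE.
have cK : compact K by exact: subclosed_compact clK cY _.
have [||A [[AK clA clKA] Ax AU]] :=
    quasicomponent_refine K x (U `|` ~` closure U) cK clK Kx.
- exact: openU oU (closed_openC (@closed_closure _ U)).
- by rewrite QE; apply: setUSS => // y Ey Uy; exact: clUE' Uy Ey.
have cA0 : relatively_clopen K (A `&` U).
  split; first by move=> y [/AK].
  - have -> : A `&` U = A `&` closure U.
      apply/seteqP; split=> y [Ay Uy]; split=> //; first exact: subset_closure.
      by case: (AU _ Ay).
    exact: closedI clA (@closed_closure _ U).
  - rewrite setDIr; apply: closedU => //.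
    exact: closedI clK (open_closedC oU).
have [z E1z] := E0 true.
have [_ Uz] : (A `&` U) z.
  have : quasicomponent K x z by rewrite QE; right.
  by apply; split=> //; split=> //; exact: EU.
exact: clUE' (subset_closure Uz) E1z.
Qed.

(** * Dense maps into compact Hausdorff spaces *)

Lemma closed_fiber {Y : topologicalType} {R : realType} (g : Y -> R) (c : R) :
  continuous g -> closed [set y | g y = c].
Proof.
move=> cg; apply: (@preimage_closed _ _ g [set c]); last exact: closed_eq.
by move=> y _; exact: cg.
Qed.

(** Complete regularity of X gives functions k : X -> [0, 1] separating points
from closed sets; the sets where their extensions differ from 1 witness that
open sets of X come from Y. *)
Lemma extension_inducing {R : realType} {X Y : topologicalType} (e : X -> Y) :
  (forall k : X -> R, continuous k -> range k `<=` `[0, 1] ->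
     exists2 g : Y -> R, continuous g & g \o e = k) ->
  completely_regular_space X ->
  forall U : set X, open U -> exists2 U' : set Y, open U' & U = e @^-1` U'.
Proof.
move=> ext crX U oU.
exists (\bigcup_(W in [set W | open W /\ e @^-1` W `<=` U]) W).
  by apply: bigcup_open => W [].
apply/seteqP; split=> [x Ux|x [W [_ WU] Wx]]; last exact: WU.
have [k [ck k01 k0 k1]] : exists k : X -> R, [/\ continuous k,
    range k `<=` `[0, 1], k @` [set x] `<=` [set 0] & k @` (~` U) `<=` [set 1]].
  by apply/uniform_separatorP; apply: crX; [exact: open_closedC|exact].
have [g cg gk] := ext k ck k01.
have geE z : g (e z) = k z by rewrite -gk.
exists (~` [set y | g y = 1]).
  split; first exact/closed_openC/closed_fiber.
  move=> z /= gz; apply: contrapT => Uz; apply: gz.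
  by rewrite geE; apply: k1; exists z.
rewrite /= geE (_ : k x = 0); last by apply: k0; exists x.
by move/eqP; rewrite eq_sym oner_eq0.
Qed.

Section dense_embedding.
Context {X Y : topologicalType} {e : X -> Y}.
Hypotheses (hY : hausdorff_space Y) (cY : compact [set: Y]).
Hypotheses (ce : continuous e) (de : dense (range e)).

Lemma dense_preimage (O : set Y) : open O -> O !=set0 -> e @^-1` O !=set0.
Proof.
move=> oO O0; have [y [Oy [x _ xy]]] := de _ O0 oO.
by exists x; rewrite /= xy.
Qed.

(** Let N be an open neighbourhood of a point of V', with closure in V'.  If no
relatively clopen part of the complement of N told a point of U' apart from the
rest of U', the quasicomponent of that point would be a connected set which has
interior but is not dense. *)
Lemma indecomposable_strongly_indecomposable :
  (forall U : set X, open U -> exists2 U' : set Y, open U' & U = e @^-1` U') ->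
  indecomposable Y -> strongly_indecomposable X.
Proof.
move=> inde indY U V /inde[U' oU' ->] /inde[V' oV' ->] [u U'u] [v V'v] UV0.
have [N [oN Nv NV']] := regular_shrink hY cY (e v) V' oV' V'v.
have U'N : U' `<=` ~` N.
  move=> y U'y Ny.
  have [x [U'x Nx]] : e @^-1` (U' `&` N) !=set0.
    by apply: dense_preimage; [exact: openI|exists y].
  have : (e @^-1` U' `&` e @^-1` V') x by split=> //; exact/NV'/subset_closure.
  by rewrite UV0.
have clK : closed (~` N) by exact: open_closedC.
pose Q := quasicomponent (~` N) (e u).
have Ku : (~` N) (e u) by exact: U'N.
have QK : Q `<=` ~` N.
  move=> y; apply; split=> //; split=> //; rewrite setDv; exact: closed0.
have nQU : ~ U' `<=` Q.
  move=> U'Q; have [dQ|nQ] :=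
      indY Q (quasicomponent_connected (~` N) (e u) hY cY clK Ku).
    by have [y [Ny /QK]] := dQ N (ex_intro _ _ Nv) oN.
  suff : ((closure Q)°) (e u) by rewrite nQ.
  apply: filterS (open_nbhs_nbhs (conj oU' U'u)).
  by move=> y /U'Q; exact: subset_closure.
have [y [U'y nQy]] : exists y, U' y /\ ~ Q y.
  by move/existsNP : nQU => [y /not_implyP]; exists y.
have [A [[[AK clA clKA] Au] nAy]] :
    exists A, (relatively_clopen (~` N) A /\ A (e u)) /\ ~ A y.
  by move/existsNP : nQy => [A /not_implyP]; exists A.
exists (e @^-1` (A `|` closure N)), (e @^-1` ((~` N `\` A) `|` closure N)).
have clpre (Z : set Y) : closed Z -> closed (e @^-1` (Z `|` closure N)).
  move=> clZ; apply: preimage_closed => [x _|]; first exact: ce.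
  exact: closedU clZ (@closed_closure _ _).
split; [exact: clpre|exact: clpre|split].
- apply/esym/seteqP; split=> // x _.
  have [Nx|Nx] := pselect (N (e x)).
    by left; right; exact: subset_closure.
  by have [Ax|Ax] := pselect (A (e x)); [left; left|right; left].
- by exists u; split=> //; left.
- have [x [U'x nAx]] : e @^-1` (U' `&` ~` A) !=set0.
    by apply: dense_preimage; [exact: openI oU' (closed_openC clA)|exists y].
  by exists x; split=> //; left; split=> //; exact: U'N.
- by move=> x [[Ax|Nx] [[_ nAx]|Nx']] //; exact: NV'.
Qed.

(** The extension property plays the part that normality of X would otherwise
play: it is applied to a function k glued from A and B, whose extension is
two-valued on the closure of C. *)
Lemma strongly_indecomposable_indecomposable (R : realType) :
  (forall k : X -> R, continuous k -> range k `<=` `[0, 1] ->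
     exists2 g : Y -> R, continuous g & g \o e = k) ->
  strongly_indecomposable X -> indecomposable Y.
Proof.
move=> ext sX C conC; apply: contrapT => /not_orP[nd nn].
pose D := closure C.
have clD : closed D by exact: closed_closure.
have /connectedP conD : connected D by exact: connected_closure.
have [y0 iDy] : (D°) !=set0 by exact/set0P/eqP.
have [W [[y [oW Wy]] WC0]] := denseNE nd.
have [N [oN Ny NW]] := regular_shrink hY cY y W oW Wy.
have ND0 : closure N `&` D = set0.
  rewrite -subset0 => z [/NW Wz Dz].
  have [w [Cw Ww]] := Dz W (open_nbhs_nbhs (conj oW Wz)).
  by have : (W `&` C) w by []; rewrite WC0.
have [phi [cphi phi01 phiN phiD]] : exists phi : Y -> R,
    [/\ continuous phi, range phi `<=` `[0, 1],
        phi @` closure N `<=` [set 0] & phi @` D `<=` [set 1]].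
  apply/uniform_separatorP; have /(@normal_separatorP R) := compact_normal hY cY.
  by apply=> //; exact: closed_closure.
have phiN0 z : N z -> phi z = 0.
  by move=> Nz; apply: phiN; exists z => //; exact: subset_closure.
have phiD1 z : D z -> phi z = 1 by move=> Dz; apply: phiD; exists z.
have UV0 : e @^-1` D° `&` e @^-1` N = set0.
  rewrite -subset0 => x [/interior_subset Dx Nx].
  have : (closure N `&` D) (e x) by split=> //; exact: subset_closure.
  by rewrite ND0.
have [| | | |A [B [clA clB [AB [a [Aa Da]] [b [Bb Db]] ABN]]]] :=
    sX (e @^-1` D°) (e @^-1` N) _ _ _ _ UV0.
- by apply: open_comp => [x _|]; [exact: ce|exact: open_interior].
- by apply: open_comp => [x _|//]; exact: ce.
- by apply: dense_preimage; [exact: open_interior|exists y0].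
- by apply: dense_preimage => //; exists y.
pose k x := if x \in A then phi (e x) else 0.
have kA x : A x -> k x = phi (e x) by move=> Ax; rewrite /k mem_set.
have kB x : B x -> k x = 0.
  move=> Bx; rewrite /k; case: ifPn => // /set_mem Ax.
  exact/phiN0/ABN.
have ck : continuous k.
  apply/continuous_subspace_setT; rewrite AB.
  apply: withinU_continuous => //.
  - apply: (@subspace_eq_continuous _ _ _ (phi \o e)).
      by move=> x /set_mem Ax; rewrite /from_subspace/= (kA _ Ax).
    apply: continuous_subspaceT => x.
    exact: continuous_comp (ce x) (cphi (e x)).
  - apply: (@subspace_eq_continuous _ _ _ (fun=> 0)).
      by move=> x /set_mem Bx; rewrite /from_subspace/= (kB _ Bx).
    by apply: continuous_subspaceT => x; exact: cvg_cst.
have [|g cg gk] := ext k ck.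
  move=> _ [x _ <-]; rewrite /k; case: ifP => _.
    by apply: phi01; exists (e x).
  by rewrite /= in_itv /= lexx ler01.
(* The set of z with g z = 0 or g z = phi z is closed and contains e(X). *)
have gE z : g z = 0 \/ g z = phi z.
  pose Z := [set z | g z = 0] `|` [set z | (g \- phi) z = 0].
  suff : Z z by move=> [|/eqP]; [left|rewrite subr_eq0 => /eqP; right].
  have clZ : closed Z.
    apply: closedU; apply: closed_fiber => // w.
    by apply: cvgB; [exact: cg|exact: cphi].
  apply: contrapT => nZ.
  have [x] := dense_preimage _ (closed_openC clZ) (ex_intro _ z nZ).
  apply; rewrite /Z/=.
  have gkx : g (e x) = k x by rewrite -gk.
  rewrite gkx; have [Ax|Bx] : (A `|` B) x by rewrite -AB.
    by right; rewrite kA // subrr.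
  by left; exact: kB.
pose E (i : bool) := D `&` [set z | g z = i%:R].
apply: (conD E); split.
- case; rewrite /E.
    exists (e a); split; first exact: interior_subset.
    have := congr1 (@^~ a) gk; rewrite /= kA // phiD1 //.
    exact: interior_subset.
  exists (e b); split; first exact: interior_subset.
  by have := congr1 (@^~ b) gk; rewrite /= kB.
- rewrite /E -setIUr; apply/esym/setIidPl => z Dz /=.
  by have [->|->] := gE z; [left|right; rewrite phiD1].
- have clE i : closed (E i).
    exact: closedI clD (closed_fiber _ _ cg).
  have E01 : E false `&` E true = set0.
    rewrite -subset0 => z [[_ /= gz0] [_ /= /eqP]].
    by rewrite gz0 eq_sym oner_eq0.
  by split; rewrite -(iffLR (closure_id _)).
Qed.

End dense_embedding.

(** * The Stone-Čech compactification *)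

Lemma set_type_hausdorff {T : topologicalType} (A : set T) :
  hausdorff_space T -> hausdorff_space A.
Proof.
move=> hT p q pq; apply: val_inj; apply: hT => P Q nP nQ.
have cv : continuous (set_val : A -> T) by exact: initial_continuous.
by have [z [Pz Qz]] := pq _ _ (cv p P nP) (cv q Q nQ); exists (set_val z).
Qed.

Lemma set_type_compact {T : topologicalType} (A : set T) :
  compact A -> compact [set: A].
Proof.
move=> cA F PF _.
have valA : \forall z \near F, A (set_val z).
  by apply: nearW => z; exact: set_valP.
have [p [Ap clp]] := cA (set_val @ F) _ valA.
exists (SigSub (mem_set Ap)); split=> // P O FP [_ [[W oW <-] Wp WQ]].
have FvP : (set_val @ F) (set_val @` P).
  by rewrite /fmap/=; apply: filterS FP; exact: preimage_image.
have [_ [[z Pz <-] Wz]] := clp _ W FvP (open_nbhs_nbhs (conj oW Wp)).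
by exists z; split=> //; exact: WQ.
Qed.

Lemma continuous_to_set_type {T Z : topologicalType} (A : set T) (f : Z -> A) :
  continuous (set_val \o f) -> continuous f.
Proof.
move=> cf; apply/continuousP => _ [W oW <-].
by move/continuousP : cf; exact.
Qed.

Section stone_cech_theory.
Context {R : realType} {X : topologicalType}.

Lemma stone_cech_hausdorff : hausdorff_space (stone_cech R X).
Proof.
apply: set_type_hausdorff; apply: hausdorff_product => f.
exact/set_type_hausdorff/Rhausdorff.
Qed.

Lemma stone_cech_compact : compact [set: stone_cech R X].
Proof.
have cI : compact [set: unit_interval R].
  by apply: set_type_compact; exact: segment_compact.
have cC : compact [set: stone_cech_cube R X].
  have := tychonoff (fun _ : continuousType X (unit_interval R) => cI).
  by congr compact; apply/seteqP; split.
apply: set_type_compact; apply: subclosed_compact cC _ => //.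
exact: closed_closure.
Qed.

Definition stone_cech_unit (x : X) : stone_cech R X :=
  SigSub (mem_set (subset_closure (imageT (@stone_cech_eval R X) x))).

Lemma stone_cech_unit_continuous : continuous stone_cech_unit.
Proof.
apply: continuous_to_set_type => x; apply/cvg_sup => f.
move=> O [_ [[W oW <-] Wfx] WO]; apply: (filterS WO).
exact: (@cts_fun _ _ f x) (open_nbhs_nbhs (conj oW Wfx)).
Qed.

Lemma stone_cech_unit_dense : dense (range stone_cech_unit).
Proof.
move=> O [p Op] [W oW WO]; rewrite -{}WO in Op *; have clp := set_valP p.
have [_ [[x _ <-] Wx]] := clp W (open_nbhs_nbhs (conj oW Op)).
by exists (stone_cech_unit x); split=> //; exists x.
Qed.

(** Extending k is projecting to a coordinate: k is itself one of the indices of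
the cube. *)
Lemma stone_cech_extension (k : X -> R) :
  continuous k -> range k `<=` `[0, 1] ->
  exists2 g : stone_cech R X -> R, continuous g & g \o stone_cech_unit = k.
Proof.
move=> ck k01.
pose f x : unit_interval R := SigSub (mem_set (k01 _ (imageT k x))).
have cf : continuous f by exact: continuous_to_set_type.
pose h : continuousType X (unit_interval R) := mkcts cf.
pose pr : stone_cech_cube R X -> unit_interval R := fun q => q h.
exists (fun p => set_val (pr (set_val p))) => //.
have cv : continuous (set_val : stone_cech R X -> stone_cech_cube R X).
  exact: initial_continuous.
have cpr : continuous pr.
  exact: (@proj_continuous _ (fun=> unit_interval R) h).
have ci : continuous (set_val : unit_interval R -> R).
  exact: initial_continuous.
move=> p; have := continuous_comp (continuous_comp (cv p) (cpr _)) (ci _).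
exact.
Qed.

End stone_cech_theory.

Theorem theorem4 (R : realType) (X : topologicalType)
    (hX : tychonoff_space X) :
  indecomposable (stone_cech R X) <-> strongly_indecomposable X.
Proof.
have [hY cY] := (@stone_cech_hausdorff R X, @stone_cech_compact R X).
have [ce de] := (@stone_cech_unit_continuous R X, @stone_cech_unit_dense R X).
have ext := @stone_cech_extension R X.
split.
  apply: (indecomposable_strongly_indecomposable hY cY ce de).
  exact: extension_inducing ext hX.1.
exact: strongly_indecomposable_indecomposable hY cY ce de R ext.
Qed.
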